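(* The following two statements are equivalent. (i) The grammar $G$ is totally ambiguous: for every $n\ge 1$ and every pair $T_1,T_2$ of $n$-leaf binary trees there is a word $w$ of length $n$ on $\{0,1,2\}$ parsed by both $T_1$ and $T_2$. (ii) For every $n\ge 1$ and every pair of $n$-bracketings there exists an $n$-tuple $(v_1,\dots,v_n)\in\{\hat\imath,\hat\jmath,\hat k\}^n$ such that the two bracketings of $v_1\times v_2\times\cdots\times v_n$ evaluate to the same nonzero vector of $\mathbb{R}^3$.
   Context: A binary tree is a rooted ordered tree in which each vertex has either $0$ or $2$ children; its leaves are ordered left to right. Let $G$ be the context-free grammar with start symbols $0,1,2$ and rules $0\to 12$, $0\to 21$, $1\to 02$, $1\to 20$, $2\to 01$, $2\to 10$. An $n$-leaf binary tree $T$ parses a word $w$ of length $n$ on $\{0,1,2\}$ if there is a labeling of the vertices of $T$ by $0,1,2$ such that the leaves, from left to right, are labeled with the letters of $w$, and at every internal vertex the label of the vertex together with the labels of its left and right children form a rule of $G$ (i.e. the three labels are pairwise distinct). $\hat\imath,\hat\jmath,\hat k$ are the standard unit vectors of $\mathbb{R}^3$ and $\times$ is the cross product, which is not associative. An $n$-bracketing is a full parenthesization of the expression $v_1\times v_2\times\cdots\times v_n$ (keeping the order of the factors), specifying how the $n-1$ binary cross products are to be computed; $n$-bracketings are in bijection with $n$-leaf binary trees, the leaves being assigned $v_1,\dots,v_n$ from left to right and each internal vertex being assigned the cross product (left child) $\times$ (right child). *)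

(* Defs.v *)
From mathcomp Require Import all_boot all_order all_algebra.
From mathcomp Require Import reals.
Set Implicit Arguments.
Unset Strict Implicit.
Unset Printing Implicit Defensive.
Import GRing.Theory.
Local Open Scope ring_scope.

Inductive bintree : Type :=
| Leaf
| Node of bintree & bintree.

Fixpoint nleaves (T : bintree) : nat :=
  match T with
  | Leaf => 1%N
  | Node T1 T2 => (nleaves T1 + nleaves T2)%N
  end.

(* An [ltree] is a binary tree together with a label in {0,1,2} at each of its
   vertices, internal ones included; a labeling of the vertices of T is an
   [ltree] of shape T. *)
Inductive ltree : Type :=
| LLeaf of 'I_3
| LNode of 'I_3 & ltree & ltree.

Fixpoint shape (L : ltree) : bintree :=
  match L with
  | LLeaf _ => Leaf
  | LNode _ L1 L2 => Node (shape L1) (shape L2)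
  end.

Definition root_label (L : ltree) : 'I_3 :=
  match L with
  | LLeaf c => c
  | LNode c _ _ => c
  end.

Fixpoint leaf_word (L : ltree) : seq 'I_3 :=
  match L with
  | LLeaf c => [:: c]
  | LNode _ L1 L2 => leaf_word L1 ++ leaf_word L2
  end.

(* The production rules of G; (a, (b, c)) stands for a -> bc. Here 0, 1, 2 are
   the three elements of 'I_3. All of them are start symbols, so the label of
   the root of a parse tree is unconstrained. *)
Definition G_rules : seq ('I_3 * ('I_3 * 'I_3)) :=
  [:: (0, (1, 2)); (0, (2, 1));
      (1, (0, 2)); (1, (2, 0));
      (2, (0, 1)); (2, (1, 0))].

Fixpoint respects_rules (L : ltree) : bool :=
  match L with
  | LLeaf _ => true
  | LNode c L1 L2 =>
      [&& (c, (root_label L1, root_label L2)) \in G_rules,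
          respects_rules L1 & respects_rules L2]
  end.

Definition parses (T : bintree) (w : seq 'I_3) : Prop :=
  exists L : ltree, [/\ shape L = T, leaf_word L = w & respects_rules L].

Definition totally_ambiguous : Prop :=
  forall n : nat, (1 <= n)%N ->
  forall T1 T2 : bintree, nleaves T1 = n -> nleaves T2 = n ->
  exists w : n.-tuple 'I_3, parses T1 w /\ parses T2 w.

Definition cross (R : realType) (u v : 'rV[R]_3) : 'rV[R]_3 :=
  \row_(k < 3) [:: u 0 1 * v 0 2 - u 0 2 * v 0 1;
                   u 0 2 * v 0 0 - u 0 0 * v 0 2;
                   u 0 0 * v 0 1 - u 0 1 * v 0 0]`_k.

Definition ihat (R : realType) : 'rV[R]_3 := delta_mx 0 0.
Definition jhat (R : realType) : 'rV[R]_3 := delta_mx 0 1.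
Definition khat (R : realType) : 'rV[R]_3 := delta_mx 0 2.

(* An n-bracketing is given by its n-leaf binary tree. [bracket_eval B v] is
   meaningful for [size v = nleaves B]: the left subtree receives the first
   factors of v and the right subtree the remaining ones. *)
Fixpoint bracket_eval (R : realType) (B : bintree) (v : seq 'rV[R]_3) :
    'rV[R]_3 :=
  match B with
  | Leaf => head 0 v
  | Node B1 B2 => cross (bracket_eval B1 (take (nleaves B1) v))
                        (bracket_eval B2 (drop (nleaves B1) v))
  end.

(* Main.v *)
(** The real quaternions settle the signs: the cross product of two orthogonal
    vectors is their quaternion product, and in a parse tree the two children
    of an internal vertex evaluate to plus or minus distinct standard unit
    vectors. Hence every tree that parses a word evaluates, on the
    corresponding unit vectors, to the quaternion product of the factors, which
    does not depend on the tree because quaternion multiplication is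
    associative. Conversely, if a bracketing of standard unit vectors does not
    vanish, all its partial products are plus or minus standard unit vectors,
    and forgetting the signs yields a parse tree. *)
Require Import Defs.
From HB Require Import structures.
From mathcomp Require Import all_boot all_order all_algebra.
From mathcomp Require Import reals.
From mathcomp Require Import ring.
Local Open Scope ring_scope.

Import GRing.Theory.

Lemma ord3P (a : 'I_3) : [\/ a = 0, a = 1 | a = 2].
Proof.
by case: a => [[|[|[|//]]] lt_a]; [constructor 1|constructor 2|constructor 3];
  apply/val_inj.
Qed.

Lemma row3P (R : realType) (u v : 'rV[R]_3) :
  u 0 0 = v 0 0 -> u 0 1 = v 0 1 -> u 0 2 = v 0 2 -> u = v.
Proof. by move=> e0 e1 e2; apply/rowP => k; case: (ord3P k) => ->. Qed.

Lemma G_rulesP (a b c : 'I_3) :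
  (c, (a, b)) \in G_rules = [&& a != b, c != a & c != b].
Proof.
by case: (ord3P a) => ->; case: (ord3P b) => ->; case: (ord3P c) => ->.
Qed.

Lemma crossE (R : realType) (u v : 'rV[R]_3) :
  (cross u v 0 0 = u 0 1 * v 0 2 - u 0 2 * v 0 1) *
  (cross u v 0 1 = u 0 2 * v 0 0 - u 0 0 * v 0 2) *
  (cross u v 0 2 = u 0 0 * v 0 1 - u 0 1 * v 0 0).
Proof. by split; [split|]; rewrite mxE. Qed.

Lemma cross_scale (R : realType) (x y : R) (u v : 'rV[R]_3) :
  cross (x *: u) (y *: v) = (x * y) *: cross u v.
Proof. by apply: row3P; rewrite !(crossE, mxE) /=; ring. Qed.

Lemma cross0v (R : realType) (u : 'rV[R]_3) : cross 0 u = 0.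
Proof. by apply: row3P; rewrite !crossE !mxE; ring. Qed.

Lemma crossv0 (R : realType) (u : 'rV[R]_3) : cross u 0 = 0.
Proof. by apply: row3P; rewrite !crossE !mxE; ring. Qed.

Lemma cross_self (R : realType) (u : 'rV[R]_3) : cross u u = 0.
Proof. by apply: row3P; rewrite !crossE !mxE; ring. Qed.

Definition dot {R : realType} (u v : 'rV[R]_3) : R :=
  u 0 0 * v 0 0 + u 0 1 * v 0 1 + u 0 2 * v 0 2.

(* The pair [(x, u)] is the quaternion with real part [x] and imaginary part
   [u]. *)
Definition quat (R : realType) : Type := (R * 'rV[R]_3)%type.

Definition qone (R : realType) : quat R := (1, 0).

(** The Hamilton product in scalar-vector form. *)
Definition qmul {R : realType} (p q : quat R) : quat R :=
  (p.1 * q.1 - dot p.2 q.2, p.1 *: q.2 + q.1 *: p.2 + cross p.2 q.2).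

Lemma qmulA (R : realType) : associative (@qmul R).
Proof.
move=> [x u] [y v] [z w]; rewrite /qmul /dot /=; congr (_, _).
  by rewrite !(crossE, mxE) /=; ring.
by apply: row3P; rewrite !(crossE, mxE) /=; ring.
Qed.

Lemma qmul1q (R : realType) : left_id (qone R) (@qmul R).
Proof.
move=> [x u]; rewrite /qmul /dot /=; congr (_, _); first by rewrite !mxE; ring.
by apply: row3P; rewrite !(crossE, mxE) /=; ring.
Qed.

Lemma qmulq1 (R : realType) : right_id (qone R) (@qmul R).
Proof.
move=> [x u]; rewrite /qmul /dot /=; congr (_, _); first by rewrite !mxE; ring.
by apply: row3P; rewrite !(crossE, mxE) /=; ring.
Qed.

(** As a monoid law, [qmul] lets [big_cat] split the product over a word where the words of two
    subtrees meet. *)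
HB.instance Definition _ (R : realType) :=
  Monoid.isLaw.Build (quat R) (qone R) (@qmul R)
    (@qmulA R) (@qmul1q R) (@qmulq1 R).

Lemma qmul_orthogonal (R : realType) (u v : 'rV[R]_3) :
  dot u v = 0 -> qmul (0, u) (0, v) = (0, cross u v).
Proof. by move=> uv0; rewrite /qmul /= uv0 mulr0 subr0 !scale0r !add0r. Qed.

Definition unit_vec (R : realType) (c : 'I_3) : 'rV[R]_3 := delta_mx 0 c.

Lemma dot_unit_vec (R : realType) (x y : R) (a b : 'I_3) : a != b ->
  dot (x *: unit_vec R a) (y *: unit_vec R b) = 0.
Proof.
by case: (ord3P a) => ->; case: (ord3P b) => -> // _;
  rewrite /dot !mxE /=; ring.
Qed.

Lemma signed_unit_vec_neq0 (R : realType) (s : bool) (c : 'I_3) :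
  (-1) ^+ s *: unit_vec R c <> 0.
Proof.
move=> /rowP/(_ c)/eqP; rewrite !mxE !eqxx mulr1.
by rewrite signr_eq0.
Qed.

Lemma cross_unit_vec (R : realType) (a b c : 'I_3) :
  (c, (a, b)) \in G_rules ->
  exists s : bool,
    cross (unit_vec R a) (unit_vec R b) = (-1) ^+ s *: unit_vec R c.
Proof.
by case: (ord3P a) => ->; case: (ord3P b) => ->; case: (ord3P c) => -> // _;
  (* The sign is plus exactly for the cyclic pairs 01, 12, 20; on a wrong guess [ring] fails and [+]
     backtracks to the other sign. *)
  (exists true + exists false); apply: row3P; rewrite crossE !mxE /=; ring.
Qed.

Lemma cross_signed_unit_vec (R : realType) (a b c : 'I_3) (s t : bool) :
  (c, (a, b)) \in G_rules ->
  exists r : bool,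
    cross ((-1) ^+ s *: unit_vec R a) ((-1) ^+ t *: unit_vec R b)
    = (-1) ^+ r *: unit_vec R c.
Proof.
move=> /(cross_unit_vec R) [r abE]; exists (s (+) t (+) r).
by rewrite cross_scale abE scalerA !signr_addb.
Qed.

Lemma size_leaf_word (L : ltree) : size (leaf_word L) = nleaves (Defs.shape L).
Proof. by elim: L => //= c L1 IH1 L2 IH2; rewrite size_cat IH1 IH2. Qed.

Lemma bracket_eval_cat (R : realType) (B1 B2 : bintree) (v1 v2 : seq 'rV[R]_3) :
  size v1 = nleaves B1 ->
  bracket_eval (Node B1 B2) (v1 ++ v2)
  = cross (bracket_eval B1 v1) (bracket_eval B2 v2).
Proof. by move=> sz1 /=; rewrite take_size_cat // drop_size_cat. Qed.

(** Induction up the tree: a rule makes the parent's label the third index, and two distinct unit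
    vectors have the third one, up to sign, as cross product. The sign may depend on the tree, so it
    is left existential here. *)
Lemma bracket_eval_parse (R : realType) (L : ltree) : respects_rules L ->
  exists s : bool,
    bracket_eval (Defs.shape L) [seq unit_vec R c | c <- leaf_word L]
    = (-1) ^+ s *: unit_vec R (root_label L).
Proof.
elim: L => [c _|c L1 IH1 L2 IH2 /and3P[rule_c ok1 ok2]].
  by exists false; rewrite scale1r.
have [[s1 E1] [s2 E2]] := (IH1 ok1, IH2 ok2).
rewrite map_cat bracket_eval_cat ?size_map ?size_leaf_word // E1 E2.
exact: cross_signed_unit_vec.
Qed.

(** The right-hand side mentions only the leaf word, so two trees parsing the same word get the same
    value, sign included. *)
Lemma bracket_eval_quat (R : realType) (L : ltree) : respects_rules L ->
  (0, bracket_eval (Defs.shape L) [seq unit_vec R c | c <- leaf_word L])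
  = \big[@qmul R/qone R]_(c <- leaf_word L) (0, unit_vec R c).
Proof.
elim: L => [c _|c L1 IH1 L2 IH2 /and3P[rule_c ok1 ok2]]; first by rewrite big_seq1.
rewrite map_cat bracket_eval_cat ?size_map ?size_leaf_word // big_cat /=.
rewrite -IH1 // -IH2 // qmul_orthogonal //.
(* Orthogonality of the two factors: they are signed unit vectors whose indices the rule at the root
   makes distinct. *)
have [[s1 ->] [s2 ->]] := (bracket_eval_parse R L1 ok1,
                           bracket_eval_parse R L2 ok2).
by apply: dot_unit_vec; move: rule_c; rewrite G_rulesP => /and3P[].
Qed.

(** A zero factor kills a cross product, so nonvanishing passes down to both subtrees, which then
    parse their parts of [w] by induction. *)
Lemma parse_of_bracket_eval (R : realType) (B : bintree) (w : seq 'I_3) :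
  size w = nleaves B ->
  bracket_eval B [seq unit_vec R c | c <- w] <> 0 -> parses B w.
Proof.
elim: B w => [|B1 IH1 B2 IH2] w.
  by case: w => [|c [|//]] // _ _; exists (LLeaf c).
move=> szw; have sz1 : size (take (nleaves B1) w) = nleaves B1.
  by rewrite size_takel // szw leq_addr.
have sz2 : size (drop (nleaves B1) w) = nleaves B2.
  by rewrite size_drop szw /= addKn.
rewrite -{1}(cat_take_drop (nleaves B1) w) map_cat bracket_eval_cat ?size_map //.
move=> nz.
have [|L1 [shape1 word1 ok1]] := IH1 _ sz1.
  by move=> E; apply: nz; rewrite E cross0v.
have [|L2 [shape2 word2 ok2]] := IH2 _ sz2.
  by move=> E; apply: nz; rewrite E crossv0.
move: nz; rewrite -word1 -word2 -shape1 -shape2.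
have [[s1 ->] [s2 ->]] := (bracket_eval_parse R L1 ok1,
                           bracket_eval_parse R L2 ok2).
(* Equal root labels would make the two factors parallel and their cross product zero. *)
have [-> nz|neq12 _] := eqVneq (root_label L1) (root_label L2).
  by case: nz; rewrite cross_scale cross_self scaler0.
(* The new root takes the remaining third letter. *)
have [c rule_c] : exists c, (c, (root_label L1, root_label L2)) \in G_rules.
  case: (ord3P (root_label L1)) neq12 => ->;
    case: (ord3P (root_label L2)) => -> // _;
    by [exists 0 | exists 1 | exists 2].
exists (LNode c L1 L2); split=> //=; last by rewrite rule_c ok1 ok2.
by rewrite word1 word2 cat_take_drop.
Qed.

Lemma unit_vec_seq (R : realType) (v : seq 'rV[R]_3) :
  {subset v <= [:: ihat R; jhat R; khat R]} ->
  exists w : seq 'I_3, v = [seq unit_vec R c | c <- w].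
Proof.
elim: v => [_|u v IH sub_uv]; first by exists [::].
have [|w ->] := IH; first by move=> x xv; apply: sub_uv; rewrite inE xv orbT.
have [c ->] : exists c, u = unit_vec R c.
  have := sub_uv u (mem_head u v).
  by rewrite !inE => /or3P[] /eqP ->; [exists 0 | exists 1 | exists 2].
by exists (c :: w).
Qed.

Theorem mainTheorem11 (R : realType) :
  totally_ambiguous <->
  (forall n : nat, (1 <= n)%N ->
   forall B1 B2 : bintree, nleaves B1 = n -> nleaves B2 = n ->
   exists v : n.-tuple 'rV[R]_3,
     [/\ forall k : 'I_n, tnth v k \in [:: ihat R; jhat R; khat R],
         bracket_eval B1 v = bracket_eval B2 v
       & bracket_eval B1 v <> 0]).
Proof.
split=> [amb | brk] n n_gt0 B1 B2 sz1 sz2.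
  have [w [[L1 [<- word1 ok1]] [L2 [<- word2 ok2]]]] := amb n n_gt0 B1 B2 sz1 sz2.
  exists (map_tuple (unit_vec R) w); split=> [k||] /=.
  - rewrite tnth_map; case: (ord3P (tnth w k)) => ->;
      by rewrite !inE eqxx ?orbT.
  (* Both values are the imaginary part of one quaternion product over [w]. *)
  - have := bracket_eval_quat R L1 ok1; rewrite word1 -word2.
    by rewrite -(bracket_eval_quat R L2 ok2) => -[].
  - have [s] := bracket_eval_parse R L1 ok1; rewrite word1 => ->.
    exact: signed_unit_vec_neq0.
have [v [v_unit evalE eval_nz]] := brk n n_gt0 B1 B2 sz1 sz2.
have [|w vE] := unit_vec_seq R v; first by move=> x /tnthP[k ->].
have sz_w : size w = n by rewrite -(size_map (unit_vec R)) -vE size_tuple.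
rewrite vE in evalE eval_nz; exists (Tuple (introT eqP sz_w)).
split; apply: (@parse_of_bracket_eval R); rewrite /= ?sz1 ?sz2 //.
(* Equality of the two values carries nonvanishing over to [B2]. *)
by rewrite -evalE.
Qed.
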